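(* Let $T_1^*\in(\tfrac12,1)$, and suppose that Assumptions 1 and 2 stated in the context hold for this $T_1^*$. Define $$f(T_1^*,x):=T_1^{*2}\,\frac{I(T_1^*+x)-I(T_1^* )-I'(T_1^* )x}{x^2},\qquad x\in(-T_1^*,0).$$ Then there is a unique point $y^*=y^*(T_1^* )\in(-T_1^*,0)$ at which the function $x\mapsto f(T_1^*,x)$ attains its global minimum on $(-T_1^*,0)$, and $$\lim_{\epsilon\downarrow 0}\epsilon^{-2/3}\,s_\infty\big(T_1^*,\,T_1^{*3}-T_1^{*3}\epsilon\big)=f(T_1^*,y^* )\in(0,\infty).$$
   Context: Graphons. $W$ is the space of measurable functions $h:[0,1]^2\to[0,1]$ with $h(x,y)=h(y,x)$. Two graphons are identified if $h_1(x,y)=h_2(\sigma x,\sigma y)$ for a measure-preserving bijection $\sigma$ of $[0,1]$; the quotient space is $\tilde W$ (with the cut metric). For $h\in W$, $T_1(h)=\int_{[0,1]^2}h(x_1,x_2)\,dx_1dx_2$ (edge density) and $T_2(h)=\int_{[0,1]^3}h(x_1,x_2)h(x_2,x_3)h(x_3,x_1)\,dx_1dx_2dx_3$ (triangle density). For $u\in[0,1]$, $I(u)=\tfrac12u\log u+\tfrac12(1-u)\log(1-u)$ (with $0\log 0=0$), and $I(h)=\int_{[0,1]^2}I(h(x,y))\,dx\,dy$. These functionals are well defined on $\tilde W$. Ensembles. $\mathcal G_n$ is the set of simple undirected graphs on $\{1,\dots,n\}$. For $G\in\mathcal G_n$, $\vec T(G)=(t(K_2,G),t(K_3,G))$ is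 the vector of homomorphism densities of the edge and the triangle, $t(F,G)=\mathrm{hom}(F,G)/n^{|V(F)|}$. Given a value $\vec T^*_n$ realised by at least one $G\in\mathcal G_n$, the microcanonical ensemble $\mathrm P_{\mathrm{mic}}$ is the uniform distribution on $\{G\in\mathcal G_n:\vec T(G)=\vec T_n^*\}$, and the canonical ensemble is $\mathrm P_{\mathrm{can}}(G)=e^{n^2[\vec\theta_n^*\cdot\vec T(G)-\psi_n(\vec\theta_n^* )]}$, where $\psi_n(\vec\theta)=n^{-2}\log\sum_{G\in\mathcal G_n}e^{n^2\vec\theta\cdot\vec T(G)}$ and $\vec\theta_n^*\in\mathbb R^2$ is the (unique) parameter such that the $\mathrm P_{\mathrm{can}}$-average of $\vec T$ equals $\vec T_n^*$. Standing convention: $\vec T_n^*\to(T_1^*,T_2^* )$ and $\vec\theta_n^*\to\vec\theta^*_\infty$ as $n\to\infty$. The specific relative entropy is $$s_\infty(T_1^*,T_2^* )=\lim_{n\to\infty}\frac1{n^2}\sum_{G\in\mathcal G_n}\mathrm P_{\mathrm{mic}}(G)\log\frac{\mathrm P_{\mathrm{mic}}(G)}{\mathrm P_{\mathrm{can}}(G)}.$$ It is known (from earlier work) that, with $\tilde W^*=\{\tilde h\in\tilde W: T_1(\tilde h)=T_1^*,\,T_2(\tilde h)=T_2^*\}$ and $\vec T=(T_1,T_2)$, $$s_\infty(T_1^*,T_2^* )=\sup_{\tilde h\in\tilde W}[\vec\theta^*_\infty\cdot\vec T(\tilde h)-I(\tilde h)]-\sup_{\tilde h\in\tilde W^*}[\vec\theta^*_\infty\cdot\vec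 T(\tilde h)-I(\tilde h)].$$ Assumption 1. For fixed edge density $T_1^*\in(0,1)$ and triangle density $T_1^{*3}+\epsilon$ ($\epsilon$ of either sign), let $(\theta_1^*(\epsilon),\theta_2^*(\epsilon))$ be the associated limiting Lagrange multipliers $\vec\theta^*_\infty$. Then, for $\epsilon$ sufficiently small, $$\sup_{\tilde h\in\tilde W}\big[\theta_1^*(\epsilon)T_1(\tilde h)+\theta_2^*(\epsilon)T_2(\tilde h)-I(\tilde h)\big]=[\theta_1T_1^*-I(T_1^* )]+(\gamma_1T_1^*+\gamma_2T_1^{*3})\epsilon+O(\epsilon^2),$$ where $\theta_1=\theta_1^*(0)=I'(T_1^* )$, $\gamma_1=\theta_1^{*\prime}(0)$, $\gamma_2=\theta_2^{*\prime}(0)$ (and $\theta_2^*(0)=0$; the multipliers are taken to be smooth in $\epsilon$ near $0$). Assumption 2. For fixed $T_1^*\in(0,1)$ and $\epsilon$ (of either sign) sufficiently small, the maximiser $h^*_\epsilon$ of $\sup\{-I(\tilde h):\tilde h\in\tilde W,\ T_1(\tilde h)=T_1^*,\ T_2(\tilde h)=T_1^{*3}+\epsilon\}$ has the form $h_\epsilon^*=T_1^*+g_{11}1_{I\times I}+g_{12}1_{(I\times J)\cup(J\times I)}+g_{22}1_{J\times J}$ for some $g_{11},g_{12},g_{22}\in[-T_1^*,1-T_1^*]$ and $I\subset[0,1]$, $J=[0,1]\setminus I$. *)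

(* Defs.v *)
(* MathComp / MathComp-Analysis *)
From HB Require Import structures.
From mathcomp Require Import all_boot all_order all_algebra.
From mathcomp Require Import all_classical all_reals all_analysis.

Set Implicit Arguments.
Unset Strict Implicit.
Unset Printing Implicit Defensive.

Import Order.TTheory GRing.Theory Num.Theory numFieldNormedType.Exports.

Local Open Scope classical_set_scope.
Local Open Scope ring_scope.

Section FiniteGraphs.
Variable R : realType.

(* A simple graph on n vertices is encoded by its adjacency matrix. *)
Definition simple_graphs (n : nat) : {set 'M[bool]_n} :=
  [set A : 'M[bool]_n | [forall i, ~~ A i i] && (A^T == A)].

Definition complete_graph (k : nat) : 'M[bool]_k := \matrix_(i, j) (i != j).

Definition hom_count (k n : nat) (F : 'M[bool]_k) (G : 'M[bool]_n) : nat :=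
  #|[set phi : {ffun 'I_k -> 'I_n} |
      [forall i, forall j, F i j ==> G (phi i) (phi j)]]|.

Definition hom_density (k n : nat) (F : 'M[bool]_k) (G : 'M[bool]_n) : R :=
  (hom_count F G)%:R / n%:R ^+ k.

Definition graph_densities (n : nat) (G : 'M[bool]_n) : R * R :=
  (hom_density (complete_graph 2) G, hom_density (complete_graph 3) G).

Definition dot (a b : R * R) : R := a.1 * b.1 + a.2 * b.2.

Definition psi (n : nat) (th : R * R) : R :=
  (n%:R ^+ 2)^-1 *
  ln (\sum_(G in simple_graphs n)
        expR (n%:R ^+ 2 * dot th (graph_densities G))).

Definition P_can (n : nat) (th : R * R) (G : 'M[bool]_n) : R :=
  expR (n%:R ^+ 2 * (dot th (graph_densities G) - psi n th)).

Definition mean_can (n : nat) (th : R * R) : R * R :=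
  (\sum_(G in simple_graphs n) P_can th G * (graph_densities G).1,
   \sum_(G in simple_graphs n) P_can th G * (graph_densities G).2).

Definition level_set (n : nat) (t : R * R) : {set 'M[bool]_n} :=
  [set G in simple_graphs n | graph_densities G == t].

Definition P_mic (n : nat) (t : R * R) (G : 'M[bool]_n) : R :=
  if G \in level_set n t then (#|level_set n t|%:R)^-1 else 0.

(* The library sets ln 0 = 0, so graphs with P_mic = 0 contribute 0. *)
Definition rel_entropy (n : nat) (t th : R * R) : R :=
  \sum_(G in simple_graphs n) P_mic t G * ln (P_mic t G / P_can th G).

Definition entropy_density (t th : nat -> R * R) (n : nat) : R :=
  (n%:R ^+ 2)^-1 * rel_entropy n (t n) (th n).

Definition s_infty (t th : nat -> R * R) : R :=
  lim (entropy_density t th n @[n --> \oo]).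

(* [t] is the sequence of constraint values, [th] the sequence of Lagrange
   multipliers tuned to them.  The first two conditions are only required for
   large n: on very few vertices a realised value need not be the mean of any
   canonical ensemble. *)
Definition ensemble_sequences (tstar thstar : R * R) (t th : nat -> R * R) :
    Prop :=
  [/\ \forall n \near \oo,
        exists2 G : 'M[bool]_n, G \in simple_graphs n & graph_densities G = t n,
      \forall n \near \oo, unique (fun v => mean_can n v = t n) (th n),
      t n @[n --> \oo] --> tstar
    & th n @[n --> \oo] --> thstar].

End FiniteGraphs.

Section Graphons.
Variable R : realType.

Local Notation mu := (@lebesgue_measure R).

Definition square : set (R * R) := `[0, 1] `*` `[0, 1].
Definition cube : set (R * R * R) := square `*` `[0, 1].

(* Only the restriction of h to the unit square is relevant.  The functionals
   below are invariant under measure-preserving relabellings, so they take the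
   same set of values on graphons as on the quotient space, and all suprema are
   written over representatives. *)
Definition graphon (h : R * R -> R) : Prop :=
  [/\ measurable_fun square h,
      forall p, square p -> 0 <= h p <= 1
    & forall x y, square (x, y) -> h (x, y) = h (y, x)].

Definition T1 (h : R * R -> R) : R :=
  \int[(mu \x mu)%E]_(p in square) h p.

Definition T2 (h : R * R -> R) : R :=
  \int[((mu \x mu) \x mu)%E]_(p in cube)
     (h (p.1.1, p.1.2) * h (p.1.2, p.2) * h (p.2, p.1.1)).

Definition densities (h : R * R -> R) : R * R := (T1 h, T2 h).

(* The library sets ln 0 = 0, so rate 0 = rate 1 = 0. *)
Definition rate (u : R) : R := 2^-1 * u * ln u + 2^-1 * (1 - u) * ln (1 - u).

Definition rate_graphon (h : R * R -> R) : R :=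
  \int[(mu \x mu)%E]_(p in square) rate (h p).

Definition with_densities (tstar : R * R) : set (R * R -> R) :=
  [set h | graphon h /\ densities h = tstar].

Definition free_sup (th : R * R) : R :=
  sup [set dot th (densities h) - rate_graphon h | h in graphon].

Definition constrained_sup (tstar th : R * R) : R :=
  sup [set dot th (densities h) - rate_graphon h | h in with_densities tstar].

(* The variational characterisation of the specific relative entropy: the limit
   defining it exists and is the difference of the two suprema. *)
Definition variational_formula (tstar thstar : R * R) (t th : nat -> R * R) :
    Prop :=
  entropy_density t th n @[n --> \oo]
    --> free_sup thstar - constrained_sup tstar thstar.

Definition smooth_near (f : R -> R) (a : R) : Prop :=
  \forall x \near a, forall k, derivable (derive1n k f) x 1.

(* [th e] is the limiting multiplier vector at densities (T, T^3 + e); the two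
   derivatives at 0 play the role of gamma_1 and gamma_2. *)
Definition assumption1 (T : R) (th : R -> R * R) : Prop :=
  let th1 := fun e => (th e).1 in
  let th2 := fun e => (th e).2 in
  [/\ smooth_near th1 0 /\ smooth_near th2 0,
      th1 0 = derive1 rate T,
      th2 0 = 0
    & (fun e => free_sup (th e)
                - ((th1 0 * T - rate T)
                   + (derive1 th1 0 * T + derive1 th2 0 * T ^+ 3) * e))
      =O_ (0 : R) (fun e => e ^+ 2)].

(* The two vertex classes are A and its complement in [0, 1]. *)
Definition two_block (T : R) (h : R * R -> R) : Prop :=
  exists (g11 g12 g22 : R) (A : set R),
    [/\ [/\ - T <= g11 <= 1 - T, - T <= g12 <= 1 - T & - T <= g22 <= 1 - T],
        measurable A,
        A `<=` `[0, 1]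
      & let B := `[0, 1] `\` A in
        forall p, square p ->
          h p = T + g11 * \1_(A `*` A) p
                  + g12 * \1_((A `*` B) `|` (B `*` A)) p
                  + g22 * \1_(B `*` B) p].

Definition assumption2 (T : R) : Prop :=
  \forall e \near (0 : R)^',
    exists h, [/\ with_densities (T, T ^+ 3 + e) h,
                  forall h', with_densities (T, T ^+ 3 + e) h' ->
                    - rate_graphon h' <= - rate_graphon h
                & two_block T h].

Definition f (T x : R) : R :=
  T ^+ 2 * (rate (T + x) - rate T - derive1 rate T * x) / x ^+ 2.

Definition argmin_f (T y : R) : Prop :=
  - T < y < 0 /\ forall x, - T < x < 0 -> f T y <= f T x.

End Graphons.

(* Main.v *)
(* Up to O(e) the specific relative entropy at (T, T^3 + e) is inf I(h) - I(T),
   the infimum being over graphons h = T + g with these densities: Assumption 1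
   and the differentiability of the multipliers take care of the rest.

   Put c := I'(T) / (2 T - 1).  By the symmetry u |-> 1 - u, the parabola
   I(T) + I'(T) (u - T) + c (u - T)^2 lies below I and touches it exactly at T
   and at 1 - T, so f(T, .) is minimal at 1 - 2 T, with value c T^2.

   Lower bound: as g has mean zero, T_2(T + g) = T^3 + 3 T |deg g|^2 + t(K_3, g),
   and t(K_3, g) >= - (int g^2)^(3/2) by Cauchy-Schwarz.  A triangle density
   T^3 - T^3 r^3 thus forces int g^2 >= T^2 r^2, hence
   I(h) - I(T) >= c int g^2 >= c T^2 r^2, for every such graphon h.

   Upper bound: take g(x, y) = (1 - 2 T) u(x) u(y) with u = 1 on an interval and
   u = - mu elsewhere, of mean zero, and mu = T r / (2 T - 1).  The densities are
   exact, and I(h) - I(T) = c T^2 r^2 + O(r^3) because h = 1 - T on the block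
   that carries almost all of int g^2. *)
Require Import Defs.
From HB Require Import structures.
From mathcomp Require Import all_boot all_order all_algebra.
From mathcomp Require Import all_classical all_reals all_analysis.
From mathcomp Require Import measurable_realfun ring lra.

Set Implicit Arguments.
Unset Strict Implicit.

Import Order.TTheory GRing.Theory Num.Theory numFieldNormedType.Exports.

Local Open Scope classical_set_scope.
Local Open Scope ring_scope.

(** * The rate function and its tangent parabola *)

Section RateFunction.
Variable R : realType.
Implicit Types u x T : R.

Definition drate u : R := 2^-1 * (ln u - ln (1 - u)).

Lemma is_derive_ln1B u : u < 1 ->
  is_derive u 1 (fun v => ln (1 - v)) (- (1 - u)^-1).
Proof.
move=> u1.
have h : is_derive (1 - u) 1 (@ln R) (1 - u)^-1.
  by apply: is_derive1_ln; rewrite subr_gt0.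
have h1 : is_derive u 1 (fun v : R => 1 - v) (- 1).
  by apply: is_derive_eq; rewrite add0r mul1r.
have := @is_derive1_comp _ (@ln R) (fun v => 1 - v) u _ _ h h1.
by rewrite mulrN1.
Qed.

Lemma is_derive_rate u : 0 < u < 1 -> is_derive u 1 (@rate R) (drate u).
Proof.
move=> /andP[u0 u1]; rewrite /rate.
have h := is_derive1_ln u0; have h1 := is_derive_ln1B u1.
apply: is_derive_eq; rewrite /drate /GRing.scale/=.
have ? : u != 0 by rewrite gt_eqF.
have ? : 1 - u != 0 by rewrite gt_eqF// subr_gt0.
by field; exact/andP.
Qed.

Lemma derive1_rate u : 0 < u < 1 -> derive1 (@rate R) u = drate u.
Proof. by move=> /is_derive_rate h; rewrite derive1E derive_val. Qed.

Lemma is_derive_drate u : 0 < u < 1 ->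
  is_derive u 1 drate (2^-1 * (u^-1 + (1 - u)^-1)).
Proof.
move=> /andP[u0 u1]; rewrite /drate.
have h := is_derive1_ln u0; have h1 := is_derive_ln1B u1.
by apply: is_derive_eq; rewrite /GRing.scale/=; ring.
Qed.

Lemma MVT01 (F dF : R -> R) (a b : R) :
  (forall x, 0 < x < 1 -> is_derive x 1 F (dF x)) ->
  0 < a -> a < b -> b < 1 ->
  exists2 m, a < m < b & F b - F a = dF m * (b - a).
Proof.
move=> dFP a0 ab b1.
have dFab x : x \in `[a, b] -> is_derive x 1 F (dF x).
  rewrite in_itv/= => /andP[ax xb]; apply: dFP.
  by rewrite (lt_le_trans a0 ax) (le_lt_trans xb b1).
have cF : {within `[a, b], continuous F}.
  by apply: derivable_within_continuous => x /dFab/@ex_derive.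
have dF' x : x \in `]a, b[ -> is_derive x 1 F (dF x).
  by move=> xab; apply: dFab; exact: subset_itv_oo_cc xab.
have [m mab Fm] := MVT ab dF' cF.
by exists m => //; move: mab; rewrite in_itv.
Qed.

Lemma drate_half : drate 2^-1 = 0.
Proof. by rewrite /drate (_ : 1 - 2^-1 = 2^-1) ?subrr ?mulr0//; lra. Qed.

Lemma drate_gt0 T : 2^-1 < T < 1 -> 0 < drate T.
Proof.
move=> /andP[T2 T1]; rewrite /drate mulr_gt0// subr_gt0 ltr_ln ?posrE; lra.
Qed.

(** The second derivative of [rate] at u is 1/(2u(1 - u)), and u(1 - u) decreases on [1/2, 1). *)
Lemma ddrate_lt (a b : R) : 2^-1 <= a -> a < b -> b < 1 ->
  2^-1 * (a^-1 + (1 - a)^-1) < 2^-1 * (b^-1 + (1 - b)^-1).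
Proof.
move=> a2 ab b1; rewrite ltr_pM2l//.
have E (x : R) : 2^-1 <= x -> x < 1 -> x^-1 + (1 - x)^-1 = (x * (1 - x))^-1.
  move=> x2 x1; have ? : x != 0 by lra.
  have ? : 1 - x != 0 by lra.
  by field; exact/andP.
have P (x : R) : 2^-1 <= x -> x < 1 -> 0 < x * (1 - x).
  by move=> x2 x1; rewrite mulr_gt0//; lra.
have b2 : 2^-1 <= b by lra.
have a1 : a < 1 by lra.
rewrite !E// ltf_pV2 ?posrE ?P//; nra.
Qed.

(* Slope at which the parabola [c * (u - 1/2)^2] is doubly tangent to the rate
   function, at [T] and [1 - T]. *)
Definition tangency T : R := drate T / (2 * T - 1).

Lemma tangency_gt0 T : 2^-1 < T < 1 -> 0 < tangency T.
Proof.
move=> T1; rewrite divr_gt0 ?drate_gt0//; move/andP: T1 => []; lra.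
Qed.

(** Centred at 1/2, the parabola shares the symmetry u -> 1 - u of [rate], so on (0, 1) it is enough
    to study [gap] on [1/2, 1). *)
Let gap T u := rate u - tangency T * (u - 2^-1) ^+ 2.
Let dgap T u := drate u - 2 * tangency T * (u - 2^-1).

Let is_derive_gap T u : 0 < u < 1 -> is_derive u 1 (gap T) (dgap T u).
Proof.
move=> /is_derive_rate h; rewrite /gap.
by apply: is_derive_eq; rewrite /dgap /GRing.scale/=; ring.
Qed.

Let is_derive_dgap T u : 0 < u < 1 -> is_derive u 1 (dgap T)
  (2^-1 * (u^-1 + (1 - u)^-1) - 2 * tangency T).
Proof.
move=> /is_derive_drate h; rewrite /dgap.
by apply: is_derive_eq; rewrite /GRing.scale/=; ring.
Qed.

Let dgap_half T : dgap T 2^-1 = 0.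
Proof. by rewrite /dgap drate_half subrr mulr0 subr0. Qed.

Let dgap_T T : 2^-1 < T -> dgap T T = 0.
Proof.
move=> T2; rewrite /dgap /tangency; have ? : 2 * T - 1 != 0 by lra.
by field.
Qed.

(* [dgap] vanishes at 1/2 and T and is convex in between. *)
Let dgap_lt0 T u : T < 1 -> 2^-1 < u -> u < T -> dgap T u < 0.
Proof.
move=> T1 u2 uT; rewrite ltNge; apply/negP => k0.
have [|||a /andP[a1 a2] ea] := MVT01 (is_derive_dgap T) (a := 2^-1) (b := u);
  [lra|lra|lra|].
have [|||b /andP[b1 b2] eb] := MVT01 (is_derive_dgap T) (a := u) (b := T);
  [lra|lra|lra|].
have ab : 2^-1 * (a^-1 + (1 - a)^-1) < 2^-1 * (b^-1 + (1 - b)^-1).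
  by apply: ddrate_lt; lra.
pose D x := 2^-1 * (x^-1 + (1 - x)^-1) - 2 * tangency T.
move: ea eb; rewrite dgap_half dgap_T ?subr0 ?sub0r; last lra.
rewrite -/(D a) -/(D b) => ea eb.
(* The mean slope of [dgap] is nonnegative on [1/2, u] and nonpositive on [u, T], against the strict
   increase of its slope. *)
have Da : 0 <= D a.
  by rewrite -(pmulr_lge0 (D a) (x := u - 2^-1)) ?subr_gt0// -ea.
have Db : D b <= 0.
  by rewrite -(pmulr_lle0 (D b) (x := T - u)) ?subr_gt0// -eb oppr_le0.
by have := le_trans Db Da; rewrite /D; lra.
Qed.

(** Rolle on [1/2, T] gives a zero of the slope of [dgap]. The slope is increasing, hence positive
    past T, where [dgap] starts from 0. *)
Let dgap_gt0 T u : 2^-1 < T -> T < u -> u < 1 -> 0 < dgap T u.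
Proof.
move=> T2 Tu u1.
have [|||a /andP[a1 a2] ea] := MVT01 (is_derive_dgap T) (a := 2^-1) (b := T);
  [lra|lra|lra|].
have [|||b /andP[b1 b2] eb] := MVT01 (is_derive_dgap T) (a := T) (b := u);
  [lra|lra|lra|].
have ab : 2^-1 * (a^-1 + (1 - a)^-1) < 2^-1 * (b^-1 + (1 - b)^-1).
  by apply: ddrate_lt; lra.
move: ea eb; rewrite dgap_half dgap_T ?subr0//.
move/esym/eqP; rewrite mulf_eq0 => /orP[/eqP ea|/eqP]; last lra.
by move=> ->; apply: mulr_gt0; lra.
Qed.

(** By the signs of [dgap], [gap] decreases on [1/2, T] and increases on [T, 1). *)
Let gap_lt_half T u : 2^-1 < T -> T < 1 -> 2^-1 <= u -> u < 1 -> u != T ->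
  gap T T < gap T u.
Proof.
move=> T2 T1 u2 u1; rewrite neq_lt => /orP[uT|Tu].
  have [|||b /andP[b1 b2] eb] := MVT01 (is_derive_gap T) (a := u) (b := T);
    [lra|lra|lra|].
  by have := dgap_lt0 T1 (le_lt_trans u2 b1) b2; nra.
have [|||b /andP[b1 b2] eb] := MVT01 (is_derive_gap T) (a := T) (b := u);
  [lra|lra|lra|].
by have := dgap_gt0 T2 b1 (lt_trans b2 u1); nra.
Qed.

Lemma rateC u : rate (1 - u) = rate u :> R.
Proof. by rewrite /rate (_ : 1 - (1 - u) = u) 1?addrC//; ring. Qed.

Let gap_lt T u : 2^-1 < T < 1 -> 0 < u < 1 -> u != T -> u != 1 - T ->
  gap T T < gap T u.
Proof.
move=> /andP[T2 T1] /andP[u0 u1] uT uT'; have [u2|u2] := leP 2^-1 u.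
  exact: gap_lt_half.
rewrite (_ : gap T u = gap T (1 - u)); last first.
  by rewrite /gap rateC; congr (_ - _ * _); field.
apply: gap_lt_half => //; [lra|lra|].
by apply: contra uT' => /eqP <-; apply/eqP; ring.
Qed.

Lemma rate_le0 u : 0 <= u <= 1 -> rate u <= 0 :> R.
Proof.
move=> /andP[u0 u1]; rewrite /rate -oppr_ge0 opprD addr_ge0//.
- by rewrite -mulrN mulr_ge0 ?oppr_ge0 ?ln_le0// mulr_ge0.
- by rewrite -mulrN mulr_ge0 ?oppr_ge0 ?ln_le0 ?mulr_ge0//; lra.
Qed.

Lemma rate0 : rate 0 = 0 :> R.
Proof. by rewrite /rate subr0 ln1 ln0// !mulr0 addr0. Qed.

Lemma rate1 : rate 1 = 0 :> R.
Proof. by rewrite -rateC subrr rate0. Qed.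

Let gap_le T u : 2^-1 < T < 1 -> 0 <= u <= 1 -> gap T T <= gap T u.
Proof.
move=> T12; have /andP[T2 T1] := T12.
have c0 := tangency_gt0 T12.
(* The right-hand side is the value of [gap T] at 0 and at 1. It is approached along 1 - s, using
   only [rate (1 - s) <= 0]; [s] is so small that T < 1 - s and that the error [tangency T * s] is
   at most [e]. *)
have E : gap T T <= - (tangency T * (2^-1) ^+ 2).
  apply/ler_addgt0Pr => e e0.
  pose s := Num.min (e / tangency T) (2^-1 * (1 - T)).
  have s0 : 0 < s by rewrite lt_min divr_gt0//= mulr_gt0//; lra.
  have sT : s <= 2^-1 * (1 - T) by rewrite ge_min lexx orbT.
  have se : tangency T * s <= e.
    by rewrite mulrC -ler_pdivlMr// ge_min lexx.
  have : gap T T <= gap T (1 - s) by apply/ltW/gap_lt_half; lra.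
  have : rate (1 - s) <= 0 by apply: rate_le0; lra.
  have : 0 <= tangency T * s ^+ 2 by rewrite mulr_ge0 ?sqr_ge0// ltW.
  rewrite (_ : gap T (1 - s) = rate (1 - s) - tangency T * (1 - s - 2^-1) ^+ 2)//.
  by lra.
move=> /andP[]; rewrite le_eqVlt => /predU1P[<- _|u0].
  by rewrite [leRHS]/gap rate0; lra.
rewrite le_eqVlt => /predU1P[->|u1].
  by rewrite [leRHS]/gap rate1; lra.
have [->//|uT] := eqVneq u T.
have [->|uT'] := eqVneq u (1 - T); last by apply/ltW/gap_lt => //; rewrite u0.
by rewrite {2}/gap rateC /gap; lra.
Qed.

(* Both inequalities come from [gap T] being minimal at [T] and [1 - T], since
   [gap T u - gap T T] is the difference of the two sides. *)
Let gapE T u : 2^-1 < T < 1 -> gap T u - gap T T =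
  rate u - (rate T + drate T * (u - T) + tangency T * (u - T) ^+ 2).
Proof.
move=> /andP[T2 T1]; rewrite /gap /tangency; have ? : 2 * T - 1 != 0 by lra.
by field.
Qed.

Lemma rate_ge_parabola T u : 2^-1 < T < 1 -> 0 <= u <= 1 ->
  rate T + drate T * (u - T) + tangency T * (u - T) ^+ 2 <= rate u.
Proof. by move=> T1 u1; rewrite -subr_ge0 -gapE// subr_ge0 gap_le. Qed.

Lemma rate_gt_parabola T u : 2^-1 < T < 1 -> 0 < u < 1 ->
    u != T -> u != 1 - T ->
  rate T + drate T * (u - T) + tangency T * (u - T) ^+ 2 < rate u.
Proof. by move=> T1 u1 uT uT'; rewrite -subr_gt0 -gapE// subr_gt0 gap_lt. Qed.

Lemma rate_parabola T : 2^-1 < T < 1 ->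
  rate (1 - T) =
  rate T + drate T * (1 - T - T) + tangency T * (1 - T - T) ^+ 2.
Proof.
move=> T1; apply/eqP; rewrite -subr_eq0 -gapE// {1}/gap rateC /gap.
by apply/eqP; field.
Qed.

Let xln_le (x t : R) : 0 < t -> 0 <= x -> x * ln x <= x * ln t + x * (x - t) / t.
Proof.
move=> t0; rewrite le_eqVlt => /predU1P[<-|x0]; first by rewrite !mul0r addr0.
rewrite -mulrA -mulrDr ler_pM2l// -lerBlDl -ln_div ?posrE//.
have -> : x / t = 1 + (x - t) / t by field; rewrite gt_eqF.
apply: le_ln1Dx; rewrite ltr_pdivlMr//; lra.
Qed.

(** The remainder of [rate] after its tangent at T is half the relative entropy of Bernoulli(u) with
    respect to Bernoulli(T), which the chi-square divergence dominates. Unlike a Taylor bound, this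
    holds up to u = 0 and u = 1. *)
Lemma rate_le_chi2 T u : 0 < T < 1 -> 0 <= u <= 1 ->
  rate u <= rate T + drate T * (u - T) + (2 * T * (1 - T))^-1 * (u - T) ^+ 2.
Proof.
move=> /andP[T0 T1] /andP[u0 u1].
have h1 := xln_le T0 u0.
have h2 : (1 - u) * ln (1 - u) <=
    (1 - u) * ln (1 - T) + (1 - u) * (1 - u - (1 - T)) / (1 - T).
  by apply: xln_le; lra.
have -> : (2 * T * (1 - T))^-1 * (u - T) ^+ 2 =
    2^-1 * (u * (u - T) / T) +
    2^-1 * ((1 - u) * (1 - u - (1 - T)) / (1 - T)).
  have ? : 1 - T != 0 by lra.
  have ? : T != 0 by lra.
  by field; do ?[apply/andP; split].
by rewrite /rate /drate; lra.
Qed.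

(** A crude bound, from x ln x >= x - 1; with [rate_le0] it makes [rate] of a kernel a bounded
    integrand. *)
Lemma rate_ge u : 0 <= u <= 1 -> - 1 <= rate u :> R.
Proof.
have xln_ge (x : R) : 0 <= x -> x - 1 <= x * ln x.
  rewrite le_eqVlt => /predU1P[<-|x0]; first by rewrite mul0r; lra.
  have : ln (1 + (x^-1 - 1)) <= x^-1 - 1.
    by apply: le_ln1Dx; have := invr_gt0 x; rewrite x0; lra.
  rewrite addrC subrK lnV ?posrE// => /(ler_wpM2l (ltW x0)).
  by rewrite mulrN mulrBr mulr1 mulfV ?gt_eqF//; lra.
move=> /andP[u0 u1]; have h1 := xln_ge _ u0.
have h2 : 1 - u - 1 <= (1 - u) * ln (1 - u) by apply: xln_ge; lra.
by rewrite /rate; lra.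
Qed.

Lemma measurable_rate : measurable_fun [set: R] (@rate R).
Proof.
rewrite /rate; apply: measurable_funD.
  by apply: measurable_funM => //; exact: measurable_funM.
have m1 : measurable_fun [set: R] (fun u : R => 1 - u).
  exact: measurable_funB.
apply: measurable_funM; first exact: measurable_funM.
exact: measurableT_comp.
Qed.

End RateFunction.

(** * Integrals of bounded measurable functions *)

Section BoundedMeasurable.
Context {d : measure_display} {X : measurableType d} {R : realType}.
Implicit Types f g : X -> R.

(** Stable under ring operations and sections, and sufficient for integrability over any set of
    finite measure, so integrability side conditions become syntactic. *)
Definition bounded_measurable f : Prop :=
  measurable_fun [set: X] f /\ exists M : R, forall x, `|f x| <= M.

Lemma bm_cst (c : R) : bounded_measurable (fun=> c).
Proof. by split; [exact: measurable_cst|exists `|c|]. Qed.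

Lemma bmD f g : bounded_measurable f -> bounded_measurable g ->
  bounded_measurable (fun x => f x + g x).
Proof.
move=> [mf [M fM]] [mg [N gN]]; split; first exact: measurable_funD.
by exists (M + N) => x; rewrite (le_trans (ler_normD _ _))// lerD.
Qed.

Lemma bmM f g : bounded_measurable f -> bounded_measurable g ->
  bounded_measurable (fun x => f x * g x).
Proof.
move=> [mf [M fM]] [mg [N gN]]; split; first exact: measurable_funM.
by exists (M * N) => x; rewrite normrM ler_pM.
Qed.

Lemma bmX f n : bounded_measurable f -> bounded_measurable (fun x => f x ^+ n).
Proof.
move=> [mf [M fM]]; split; first exact: measurable_funX.
by exists (M ^+ n) => x; rewrite normrX lerXn2r// nnegrE (le_trans _ (fM x)).
Qed.

Lemma bmN f : bounded_measurable f -> bounded_measurable (fun x => - f x).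
Proof.
move=> [mf [M fM]]; split; first exact: measurable_funN.
by exists M => x; rewrite normrN.
Qed.

Lemma bm_indic (A : set X) : measurable A -> bounded_measurable (\1_A : X -> R).
Proof.
move=> mA; split; first exact: measurable_indic.
by exists 1 => x; rewrite indicE normr_nat lern1 leq_b1.
Qed.

Lemma bm_comp d' (Y : measurableType d') f (h : Y -> X) :
  measurable_fun [set: Y] h -> bounded_measurable f ->
  measurable_fun [set: Y] (f \o h) /\ exists M, forall y, `|f (h y)| <= M.
Proof.
move=> mh [mf [M fM]]; split; first exact: measurableT_comp.
by exists M => y; exact: fM.
Qed.

Variables (m : {measure set X -> \bar R}) (A : set X).
Hypotheses (mA : measurable A) (fA : (m A < +oo)%E).

Lemma bm_integrable f : bounded_measurable f -> m.-integrable A (EFin \o f).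
Proof.
move=> [mf [M fM]]; apply: measurable_bounded_integrable => //.
  exact: measurable_funTS.
by exists M; split; [exact: num_real|move=> K MK x _; exact: le_trans (fM x) (ltW MK)].
Qed.

Lemma bm_intD f g : bounded_measurable f -> bounded_measurable g ->
  \int[m]_(x in A) (f x + g x) = \int[m]_(x in A) f x + \int[m]_(x in A) g x.
Proof. by move=> bf bg; rewrite RintegralD//; exact: bm_integrable. Qed.

Lemma bm_intZ (c : R) f : bounded_measurable f ->
  \int[m]_(x in A) (c * f x) = c * \int[m]_(x in A) f x.
Proof. by move=> bf; rewrite RintegralZl//; exact: bm_integrable. Qed.

Lemma bm_le_int f g : bounded_measurable f -> bounded_measurable g ->
  (forall x, A x -> f x <= g x) ->
  \int[m]_(x in A) f x <= \int[m]_(x in A) g x.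
Proof. by move=> bf bg fg; apply: le_Rintegral => //; exact: bm_integrable. Qed.

End BoundedMeasurable.
#[global] Hint Resolve bm_cst : core.

Section Fubini.
Context {d d' : measure_display} {X : measurableType d} {Y : measurableType d'}.
Context {R : realType}.
Variables (m : {sigma_finite_measure set X -> \bar R}).
Variables (m' : {sigma_finite_measure set Y -> \bar R}).
Variables (A : set X) (B : set Y).
Hypotheses (mA : measurable A) (fA : (m A < +oo)%E).
Hypotheses (mB : measurable B) (fB : (m' B < +oo)%E).
Variable F : X * Y -> R.
Hypothesis bF : bounded_measurable F.

Lemma bm_pair1 x : bounded_measurable (fun y => F (x, y)).
Proof. by apply: (bm_comp _ bF); exact: pair1_measurable. Qed.

Lemma bm_pair2 y : bounded_measurable (fun x => F (x, y)).
Proof. by apply: (bm_comp _ bF); exact: pair2_measurable. Qed.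

Lemma bm_int : bounded_measurable (fun x => \int[m']_(y in B) F (x, y)).
Proof.
have [mF [M FM]] := bF.
have M0 (p : X * Y) : 0 <= M by exact: le_trans (FM p).
(* Tonelli's measurability statement concerns nonnegative functions integrated over the whole space:
   F is shifted up by its bound M and B enters as an indicator. [E] below undoes the shift. *)
have mG : measurable_fun [set: X * Y]
    (fun p => ((F p + M) * \1_B p.2)%:E).
  apply/measurable_EFinP; apply: measurable_funM.
    exact: measurable_funD.
  by apply: measurableT_comp => //; exact: measurable_indic.
have G0 p : (0 <= ((F p + M) * \1_B p.2)%:E)%E.
  rewrite lee_fin mulr_ge0 ?indicE//.
  by rewrite -lerBlDr sub0r; have := FM p; rewrite ler_norml => /andP[].
have := measurable_fun_fubini_tonelli_F (m2 := m') _ mG G0; rewrite /fubini_F => mI.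
have E x : \int[m']_(y in B) F (x, y) =
    fine (\int[m']_y ((F (x, y) + M) * \1_B y)%:E) - M * fine (m' B).
  have -> : \int[m']_(y in B) F (x, y) =
      \int[m']_(y in B) ((F (x, y) + M) + - M).
    by apply: eq_Rintegral => y _; rewrite addrK.
  rewrite bm_intD ?Rintegral_cst// ?mulNr.
    congr (_ - _); rewrite Rintegral_mkcond; congr fine.
    apply: eq_integral => y _; rewrite patchE indicE.
    by case: ifPn; rewrite ?mulr1 ?mulr0.
  by apply: bmD => //; exact: bm_pair1.
split.
  rewrite (funext E); apply: measurable_funB => //.
  by apply: measurableT_comp => //; exact: measurable_fine.
exists (M * fine (m' B)) => x.
have b1 := bm_pair1 x.
rewrite -Rintegral_cst// (le_trans (le_normr_Rintegral mB _))//.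
  exact: bm_integrable.
apply: bm_le_int => //.
have [mf [N fN]] := b1; split; first exact: measurableT_comp.
by exists N => y; rewrite normr_id.
Qed.

(** Fubini's theorem is applied on the whole product space, to F extended by zero outside the
    rectangle. *)
Let FAB := F \_ (A `*` B).

Let iFAB : (m \x m')%E.-integrable [set: X * Y] (EFin \o FAB).
Proof.
have mAB : measurable (A `*` B) by exact: measurableX.
have fAB : ((m \x m')%E (A `*` B) < +oo)%E.
  by rewrite product_measure1E// lte_mul_pinfty// ge0_fin_numE.
have := (integrable_mkcond (EFin \o F) mAB).1 (bm_integrable mAB fAB bF).
by rewrite restrict_EFin.
Qed.

Let FABE x y : FAB (x, y) = if x \in A then ((fun y => F (x, y)) \_ B) y else 0.
Proof.
rewrite /FAB patchE in_setX /= !patchE.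
by case: (x \in A); case: (y \in B).
Qed.

Let FABE' x y : FAB (x, y) = if y \in B then ((fun x => F (x, y)) \_ A) x else 0.
Proof.
rewrite /FAB patchE in_setX /= !patchE.
by case: (x \in A); case: (y \in B).
Qed.

Lemma bm_fubini1 : \int[(m \x m')%E]_(p in A `*` B) F p =
  \int[m]_(x in A) \int[m']_(y in B) F (x, y).
Proof.
rewrite Rintegral_mkcond [RHS]Rintegral_mkcond /Rintegral.
rewrite -(integral12_prod_meas1 iFAB); congr fine.
apply: eq_integral => x _; rewrite /fubini_F/= patchE.
case: ifPn => xA; last first.
  by rewrite integral0_eq// => y _; rewrite FABE (negbTE xA).
rewrite fineK; last first.
  by apply: integrable_fin_num => //; apply: bm_integrable => //; exact: bm_pair1.
rewrite [RHS]integral_mkcond; apply: eq_integral => y _.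
by rewrite FABE xA !patchE; case: ifP.
Qed.

Lemma bm_fubini2 : \int[(m \x m')%E]_(p in A `*` B) F p =
  \int[m']_(y in B) \int[m]_(x in A) F (x, y).
Proof.
rewrite Rintegral_mkcond [RHS]Rintegral_mkcond /Rintegral.
rewrite -(integral21_prod_meas1 iFAB); congr fine.
apply: eq_integral => y _; rewrite /fubini_G/= patchE.
case: ifPn => yB; last first.
  by rewrite integral0_eq// => x _; rewrite FABE' (negbTE yB).
rewrite fineK; last first.
  by apply: integrable_fin_num => //; apply: bm_integrable => //; exact: bm_pair2.
rewrite [RHS]integral_mkcond; apply: eq_integral => x _.
by rewrite FABE' yB !patchE; case: ifP.
Qed.

End Fubini.

(** * Triangle integrals of symmetric kernels *)

Ltac bm := solve [repeat first
  [assumption | exact: bm_cst | apply bmD | apply bmM | apply bmX | apply bmN]].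

Section ProbabilityIntegral.
Context {d : measure_display} {X : measurableType d} {R : realType}.
Variables (m : {measure set X -> \bar R}) (A : set X).
Hypotheses (mA : measurable A) (A1 : m A = 1%E).

Let fA : (m A < +oo)%E. Proof. by rewrite A1 ltry. Qed.

Lemma bm_int_cst (c : R) : \int[m]_(x in A) c = c.
Proof. by rewrite Rintegral_cst// A1 mulr1. Qed.

Lemma bm_int_affine (a b c : R) (f g : X -> R) :
    bounded_measurable f -> bounded_measurable g ->
  \int[m]_(x in A) (a + b * f x + c * g x) =
  a + b * \int[m]_(x in A) f x + c * \int[m]_(x in A) g x.
Proof.
move=> bf bg; rewrite !(bm_intD mA fA); try bm.
by rewrite !(bm_intZ mA fA)// bm_int_cst.
Qed.

(** Applied with [a], [b], [c] the values of a kernel on the three edges of a triangle. *)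
Lemma bm_int_prod3_shift (T : R) (a b c : X -> R) :
    bounded_measurable a -> bounded_measurable b -> bounded_measurable c ->
  \int[m]_(x in A) ((T + a x) * (T + b x) * (T + c x)) =
  T ^+ 3 + T ^+ 2 * (\int[m]_(x in A) a x + \int[m]_(x in A) b x
                     + \int[m]_(x in A) c x)
         + T * (\int[m]_(x in A) (a x * b x) + \int[m]_(x in A) (b x * c x)
                + \int[m]_(x in A) (c x * a x))
         + \int[m]_(x in A) (a x * b x * c x).
Proof.
move=> ba bb bc.
rewrite -[X in X + _ + _ + _]bm_int_cst -!(bm_intD mA fA); try bm.
rewrite -!(bm_intZ mA fA); try bm.
rewrite -!(bm_intD mA fA); try bm.
by apply: eq_Rintegral => x _; ring.
Qed.

Lemma cauchy_schwarz_int (f g : X -> R) :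
    bounded_measurable f -> bounded_measurable g ->
  (\int[m]_(x in A) (f x * g x)) ^+ 2 <=
  (\int[m]_(x in A) (f x ^+ 2)) * (\int[m]_(x in A) (g x ^+ 2)).
Proof.
move=> bf bg.
have bff := bmX 2 bf; have bgg := bmX 2 bg; have bfg := bmM bf bg.
set F := \int[m]_(x in A) (f x ^+ 2); set G := \int[m]_(x in A) (g x ^+ 2).
set H := \int[m]_(x in A) (f x * g x).
have F0 : 0 <= F by apply: Rintegral_ge0 => x _; exact: sqr_ge0.
(* The integral of (t f + g)^2 as a quadratic polynomial in t. *)
have quad t : 0 <= t ^+ 2 * F + (2 * t * H + G).
  rewrite -!(bm_intZ mA fA) -?(bm_intD mA fA); try bm.
  by apply: Rintegral_ge0 => x _; have := sqr_ge0 (t * f x + g x); lra.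
have [F00|F00] := eqVneq F 0.
  have H0 : H = 0.
    apply/eqP/negPn/negP => H0.
    (* With F = 0 the polynomial is affine in t, and this t gives it the value -1. *)
    have := quad (- (G + 1) / (2 * H)); rewrite F00 mulr0 add0r.
    by rewrite (_ : 2 * _ * H = - (G + 1)); [lra|field].
  by rewrite H0 expr0n mulr_ge0//; apply: Rintegral_ge0 => x _; exact: sqr_ge0.
(* The minimiser of the quadratic. *)
have := quad (- H / F).
rewrite (_ : _ + _ = G - H ^+ 2 / F); last by field.
by rewrite subr_ge0 ler_pdivrMr ?[G * F]mulrC// lt_def F00.
Qed.

End ProbabilityIntegral.

Section Kernels.
Context {d : measure_display} {X : measurableType d} {R : realType}.
Variables (m : {sigma_finite_measure set X -> \bar R}) (D : set X).
Hypotheses (mD : measurable D) (mD1 : m D = 1%E).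
Implicit Types (g : X * X -> R) (T : R).

Local Notation m2 := (m \x m)%E.
Local Notation m3 := ((m \x m) \x m)%E.
Local Notation sq := (D `*` D).
Local Notation cb := (sq `*` D).
Local Notation Q1 f := (\int[m]_(x in D) f x).

Let msq : measurable sq. Proof. exact: measurableX. Qed.
Lemma measure_square1 : m2 sq = 1%E.
Proof. by rewrite -[RHS]mule1 product_measure1E//; congr (_ * _)%E; exact: mD1. Qed.
Let mcb : measurable cb. Proof. exact: measurableX. Qed.
Lemma measure_cube1 : m3 cb = 1%E.
Proof.
rewrite -[RHS]mule1 product_measure1E//.
by congr (_ * _)%E; [exact: measure_square1|exact: mD1].
Qed.
Let fin1 : (m D < +oo)%E. Proof. by rewrite mD1 ltry. Qed.
Let fin2 : (m2 sq < +oo)%E. Proof. by rewrite measure_square1 ltry. Qed.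

Lemma square_int (F : X * X -> R) : bounded_measurable F ->
  \int[m2]_(p in sq) F p = Q1 (fun x => Q1 (fun y => F (x, y))).
Proof. exact: (bm_fubini1 mD fin1 mD fin1). Qed.

Lemma square_int_swap (F : X * X -> R) : bounded_measurable F ->
  \int[m2]_(p in sq) F p = Q1 (fun y => Q1 (fun x => F (x, y))).
Proof. exact: (bm_fubini2 mD fin1 mD fin1). Qed.

Let sigma_finite_square : sigma_finite setT m2.
Proof.
have /sigma_finiteP[F [TF ndF Foo]] := sigma_finiteT m.
exists (fun n => F n `*` F n).
  rewrite -setXTT TF predeqE => -[x y]; split.
    move=> [/= [n _ Fnx] [k _ Fky]]; exists (maxn n k) => //; split.
      by move: x Fnx; exact/subsetPset/ndF/leq_maxl.
    by move: y Fky; exact/subsetPset/ndF/leq_maxr.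
  by move=> [n _ [/= ? ?]]; split; exists n.
move=> k; have [mF Fk] := Foo k; split; first exact: measurableX.
by rewrite product_measure1E// lte_mul_pinfty// ge0_fin_numE.
Qed.

(* Spelled out because for [m \x m] the canonical structure inference only finds
   the sigma-finite instance meant for products of probabilities. *)
Let square_measure : {sigma_finite_measure set (X * X)%type -> \bar R} :=
  HB.pack_for (SigmaFiniteMeasure.type (X * X)%type R) m2
    (Measure_isSigmaFinite.Build _ _ _ m2 sigma_finite_square).

Lemma cube_int (F : X * X * X -> R) : bounded_measurable F ->
  \int[m3]_(p in cb) F p = \int[m2]_(p in sq) Q1 (fun z => F (p, z)).
Proof.
exact: (@bm_fubini1 _ _ (X * X)%type X R square_measure m sq D msq fin2 mD fin1 F).
Qed.

Definition degree g (x : X) : R := Q1 (fun y => g (x, y)).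

Definition codegree g (p : X * X) : R := Q1 (fun z => g (p.2, z) * g (z, p.1)).

Definition triangle_int g : R := \int[m3]_(p in cb)
  (g (p.1.1, p.1.2) * g (p.1.2, p.2) * g (p.2, p.1.1)).

Lemma bm_kernel (d' : measure_display) (Y : measurableType d') g (a b : Y -> X) :
  bounded_measurable g -> measurable_fun setT a -> measurable_fun setT b ->
  bounded_measurable (fun p => g (a p, b p)).
Proof.
by move=> bg ma mb; apply: (bm_comp (f := g)) => //; exact: measurable_fun_pair.
Qed.

Lemma bm_degree g : bounded_measurable g -> bounded_measurable (degree g).
Proof. exact: (bm_int mD fin1). Qed.

Section SymmetricKernel.
Variables (g : X * X -> R) (bg : bounded_measurable g).
Hypothesis gC : forall x y, g (x, y) = g (y, x).

Let b12 : bounded_measurable (fun p : X * X * X => g (p.1.1, p.1.2)).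
Proof. by apply: bm_kernel => //; exact: measurableT_comp. Qed.
Let b23 : bounded_measurable (fun p : X * X * X => g (p.1.2, p.2)).
Proof. by apply: bm_kernel => //; exact: measurableT_comp. Qed.
Let b31 : bounded_measurable (fun p : X * X * X => g (p.2, p.1.1)).
Proof. by apply: bm_kernel => //; exact: measurableT_comp. Qed.

Let bdeg : bounded_measurable (degree g). Proof. exact: bm_degree. Qed.

Let bdeg1 : bounded_measurable (fun p : X * X => degree g p.1).
Proof. exact: (bm_comp (f := degree g)). Qed.

Let bdeg2 : bounded_measurable (fun p : X * X => degree g p.2).
Proof. exact: (bm_comp (f := degree g)). Qed.

Let bcodeg : bounded_measurable (codegree g).
Proof.
apply: (bm_int mD fin1 (F := fun p => g (p.1.2, p.2) * g (p.2, p.1.1))).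
exact: bmM.
Qed.

Let brow x : bounded_measurable (fun y => g (x, y)).
Proof. exact: bm_pair1. Qed.

Let bcol y : bounded_measurable (fun x => g (x, y)).
Proof. exact: bm_pair2. Qed.

Lemma triangle_codegree :
  triangle_int g = \int[m2]_(p in sq) (g p * codegree g p).
Proof.
rewrite /triangle_int cube_int; last by bm.
apply: eq_Rintegral => -[x y] _ /=; rewrite /codegree /= -(bm_intZ mD fin1).
  by apply: eq_Rintegral => z _; rewrite mulrA.
exact: bmM.
Qed.

(** The terms linear in g vanish because g has mean zero. Two edges of a triangle share one vertex;
    integrating out their other ends leaves the squared degree at that vertex, once for each of the
    three pairs. *)
Lemma triangle_shift T : \int[m2]_(p in sq) g p = 0 ->
  triangle_int (fun p => T + g p) =
  T ^+ 3 + 3 * T * Q1 (fun x => degree g x ^+ 2) + triangle_int g.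
Proof.
move=> g0; rewrite [LHS](bm_int_prod3_shift mcb measure_cube1)// -/(triangle_int g).
have colE y : Q1 (fun x => g (x, y)) = degree g y.
  by apply: eq_Rintegral => x _; rewrite gC.
have I12 : \int[m3]_(p in cb) g (p.1.1, p.1.2) = 0.
  rewrite cube_int// -[RHS]g0; apply: eq_Rintegral => -[x y] _ /=.
  by rewrite bm_int_cst.
have I23 : \int[m3]_(p in cb) g (p.1.2, p.2) = 0.
  by rewrite cube_int// (square_int bdeg2)/= bm_int_cst// -[RHS]g0 square_int.
have I31 : \int[m3]_(p in cb) g (p.2, p.1.1) = 0.
  rewrite cube_int//; transitivity (\int[m2]_(p in sq) degree g p.1).
    by apply: eq_Rintegral => -[x y] _ /=; rewrite colE.
  rewrite (square_int bdeg1) -[RHS]g0 square_int//.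
  by apply: eq_Rintegral => x _; rewrite /= bm_int_cst.
have J1 : \int[m3]_(p in cb) (g (p.1.1, p.1.2) * g (p.1.2, p.2)) =
    Q1 (fun x => degree g x ^+ 2).
  rewrite cube_int; last by bm.
  transitivity (\int[m2]_(p in sq) (g p * degree g p.2)).
    by apply: eq_Rintegral => -[x y] _ /=; rewrite (bm_intZ mD fin1).
  rewrite square_int_swap; last by bm.
  apply: eq_Rintegral => y _ /=.
  under eq_Rintegral do rewrite mulrC.
  by rewrite (bm_intZ mD fin1)// colE.
have J2 : \int[m3]_(p in cb) (g (p.1.2, p.2) * g (p.2, p.1.1)) =
    Q1 (fun x => degree g x ^+ 2).
  rewrite cube_int; last by bm.
  rewrite (square_int bcodeg).
  (* Here the shared vertex is the innermost variable z, so for fixed x the integrals over y and z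
     are exchanged. *)
  transitivity (\int[m2]_(p in sq) (g p * degree g p.2)).
    rewrite square_int; last by bm.
    apply: eq_Rintegral => x _.
    have bx : bounded_measurable (fun p : X * X => g p * g (p.2, x)).
      apply: bmM => //; exact: (bm_comp (f := fun z => g (z, x))).
    rewrite -(square_int bx) square_int_swap//.
    apply: eq_Rintegral => z _ /=.
    under eq_Rintegral do rewrite mulrC.
    by rewrite (bm_intZ mD fin1)// colE gC.
  rewrite square_int_swap; last by bm.
  apply: eq_Rintegral => y _ /=.
  under eq_Rintegral do rewrite mulrC.
  by rewrite (bm_intZ mD fin1)// colE.
have J3 : \int[m3]_(p in cb) (g (p.2, p.1.1) * g (p.1.1, p.1.2)) =
    Q1 (fun x => degree g x ^+ 2).
  rewrite cube_int; last by bm.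
  transitivity (\int[m2]_(p in sq) (g p * degree g p.1)).
    apply: eq_Rintegral => -[x y] _ /=.
    under eq_Rintegral do rewrite mulrC.
    by rewrite (bm_intZ mD fin1)// colE.
  rewrite square_int; last by bm.
  apply: eq_Rintegral => x _ /=.
  under eq_Rintegral do rewrite mulrC.
  by rewrite (bm_intZ mD fin1).
rewrite I12 I23 I31 J1 J2 J3; ring.
Qed.

(* Cauchy-Schwarz bounds the codegree of (x, y) by the row norms at x and y. *)
Lemma triangle_int_ge (S := \int[m2]_(p in sq) (g p ^+ 2)) :
  - triangle_int g <= S * Num.sqrt S.
Proof.
pose a := degree (fun p => g p ^+ 2).
have bg2 : bounded_measurable (fun p => g p ^+ 2) by bm.
have ba : bounded_measurable a by exact: bm_degree.
have ba1 : bounded_measurable (fun p : X * X => a p.1) by exact: (bm_comp (f := a)).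
have ba2 : bounded_measurable (fun p : X * X => a p.2) by exact: (bm_comp (f := a)).
have Qa : Q1 a = S by rewrite /S square_int.
have Qaa : \int[m2]_(p in sq) (a p.1 * a p.2) = S * S.
  rewrite square_int; last by bm.
  transitivity (Q1 (fun x => S * a x)); last by rewrite (bm_intZ mD fin1)// Qa.
  by apply: eq_Rintegral => x _ /=; rewrite (bm_intZ mD fin1)// Qa mulrC.
have cs p : codegree g p ^+ 2 <= a p.1 * a p.2.
  rewrite mulrC; apply: le_trans (cauchy_schwarz_int mD mD1 (brow _) (bcol _)) _.
  by rewrite (_ : Q1 (fun x => g (x, p.1) ^+ 2) = a p.1)//;
    apply: eq_Rintegral => x _; rewrite gC.
have S0 : 0 <= S by apply: Rintegral_ge0 => p _; exact: sqr_ge0.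
(* Pointwise, -g k <= (s g^2 + k^2 / s) / 2 for the codegree k, and k^2 is bounded by [cs]. The
   weight s = sqrt S, taken at the end, balances the two terms. *)
have amgm s : 0 < s -> - triangle_int g <= 2^-1 * s * S + (2 * s)^-1 * (S * S).
  move=> s0; rewrite triangle_codegree -mulN1r -Qaa.
  rewrite -!(bm_intZ msq fin2) -?(bm_intD msq fin2); try bm.
  apply: (bm_le_int msq fin2); try bm.
  move=> p _; have := cs p; have : 0 <= (s * g p + codegree g p) ^+ 2 by exact: sqr_ge0.
  move=> h1 h2.
  rewrite -(ler_pM2l (x := 2 * s)) ?mulr_gt0//.
  rewrite [leRHS](_ : _ = (s * g p) ^+ 2 + a p.1 * a p.2); last first.
    by field; rewrite gt_eqF.
  lra.
have [S00|S00] := eqVneq S 0.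
  by have := amgm 1 ltr01; rewrite S00 !mul0r !mulr0 addr0.
have S1 : 0 < S by rewrite lt_def S00.
have := amgm (Num.sqrt S); rewrite sqrtr_gt0 => /(_ S1).
have key (s x : R) : s != 0 -> s ^+ 2 = x ->
    2^-1 * s * x + (2 * s)^-1 * (x * x) = x * s by move=> s0 <-; field.
by rewrite key ?sqr_sqrtr// sqrtr_eq0 -ltNge.
Qed.

End SymmetricKernel.

End Kernels.

(** * Rate of a kernel with prescribed densities *)

Section KernelRate.
Context {d : measure_display} {X : measurableType d} {R : realType}.
Variables (m : {sigma_finite_measure set X -> \bar R}) (D : set X).
Hypotheses (mD : measurable D) (mD1 : m D = 1%E).
Implicit Types (h : X * X -> R) (T r : R).

Local Notation m2 := (m \x m)%E.
Local Notation sq := (D `*` D).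
Local Notation Q1 f := (\int[m]_(x in D) f x).
Local Notation Q2 f := (\int[m2]_(p in sq) f p).

Let msq : measurable sq. Proof. exact: measurableX. Qed.
Let msq1 : m2 sq = 1%E. Proof. exact: measure_square1. Qed.
Let fin1 : (m D < +oo)%E. Proof. by rewrite mD1 ltry. Qed.
Let fin2 : (m2 sq < +oo)%E. Proof. by rewrite msq1 ltry. Qed.

Lemma bm_rate h : measurable_fun setT h -> (forall p, 0 <= h p <= 1) ->
  bounded_measurable (fun p => rate (h p)).
Proof.
move=> mh h01; split.
  by apply: (measurableT_comp (f := @rate R)) => //; exact: measurable_rate.
by exists 1 => p; rewrite ler_norml rate_ge//= (le_trans (rate_le0 (h01 p))).
Qed.

Lemma kernel_rate_ge h T r : 2^-1 < T < 1 -> 0 <= r ->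
    measurable_fun setT h -> (forall p, 0 <= h p <= 1) ->
    (forall x y, h (x, y) = h (y, x)) ->
    Q2 h = T -> triangle_int m D h = T ^+ 3 - T ^+ 3 * r ^+ 3 ->
  rate T + tangency T * T ^+ 2 * r ^+ 2 <= Q2 (fun p => rate (h p)).
Proof.
move=> T12 r0 mh h01 hC hT htri; have /andP[T2 T1] := T12.
have bh : bounded_measurable h.
  split=> //; exists 1 => p; have /andP[h0 h1] := h01 p.
  by rewrite ger0_norm.
pose g p := h p - T.
have bg : bounded_measurable g by apply: bmD => //; exact: bm_cst.
have gC x y : g (x, y) = g (y, x) by rewrite /g hC.
have Qg : Q2 g = 0.
  by rewrite (bm_intD msq fin2)// ?bm_int_cst// hT subrr.
have hE : h = (fun p => T + g p) by apply/funext => p; rewrite /g addrC subrK.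
have gE p : h p - T = g p by [].
clearbody g.
set S := Q2 (fun p => g p ^+ 2).
have S0 : 0 <= S by apply: Rintegral_ge0 => p _; exact: sqr_ge0.
have bg2 : bounded_measurable (fun p => g p ^+ 2) by exact: bmX.
have rateS : rate T + tangency T * S <= Q2 (fun p => rate (h p)).
  have -> : rate T + tangency T * S =
      Q2 (fun p => rate T + drate T * g p + tangency T * g p ^+ 2).
    by rewrite bm_int_affine// Qg mulr0 addr0.
  apply: (bm_le_int msq fin2); [bm|exact: bm_rate|].
  by move=> p _; rewrite -gE; exact: rate_ge_parabola.
(* The squared degrees can only raise the triangle density, so the whole deficit must come from
   [triangle_int] of g. *)
have triS : T ^+ 3 * r ^+ 3 <= S * Num.sqrt S.
  apply: le_trans (triangle_int_ge mD mD1 bg gC).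
  have := triangle_shift mD mD1 bg gC T Qg; rewrite -hE htri.
  have : 0 <= 3 * T * Q1 (fun x => degree m D g x ^+ 2).
    rewrite mulr_ge0//; first by rewrite mulr_ge0//; lra.
    by apply: Rintegral_ge0 => x _; exact: sqr_ge0.
  lra.
have c0 := tangency_gt0 T12.
apply: le_trans rateS; rewrite lerD2l -mulrA ler_pM2l// -exprMn.
have Tr0 : 0 <= T * r by rewrite mulr_ge0//; lra.
rewrite leNgt; apply/negP => ltS.
have sltS : Num.sqrt S < T * r.
  by rewrite -(ltr_pXn2r (n := 2)) ?nnegrE ?sqrtr_ge0// sqr_sqrtr.
have := lt_le_trans (ltr_pM S0 (sqrtr_ge0 S) ltS sltS).
by rewrite -exprSr exprMn => /(_ _ triS); rewrite ltxx.
Qed.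

(** * The rank-one test kernel for the upper bound *)

Variables (I : set X).
Hypotheses (mI : measurable I) (ID : I `<=` D).

(* [cut mu] has mean zero when [I] has measure [mu / (1 + mu)]. *)
Definition cut (mu : R) (x : X) : R := (1 + mu) * \1_I x - mu.

Definition cut_kernel T (mu : R) (p : X * X) : R :=
  T - (2 * T - 1) * (cut mu p.1 * cut mu p.2).

Section CutKernel.
Variables (T mu : R).
Hypotheses (T12 : 2^-1 < T < 1) (mu0 : 0 < mu) (mu1 : mu <= 1).
Hypotheses (muT : (2 * T - 1) * mu <= 1 - T).
Hypothesis Imu : m I = (mu / (1 + mu))%:E.

Let mu1_neq0 : 1 + mu != 0. Proof. by rewrite gt_eqF// addr_gt0. Qed.

Let b1 : bounded_measurable (\1_I : X -> R). Proof. exact: bm_indic. Qed.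

Let bcut : bounded_measurable (cut mu).
Proof. by rewrite /cut; bm. Qed.

Let bcut1 : bounded_measurable (fun p : X * X => cut mu p.1).
Proof. exact: (bm_comp (f := cut mu)). Qed.

Let bcut2 : bounded_measurable (fun p : X * X => cut mu p.2).
Proof. exact: (bm_comp (f := cut mu)). Qed.

Let bI1 : bounded_measurable (fun p : X * X => \1_I p.1 : R).
Proof. exact: (bm_comp (f := \1_I)). Qed.

Let bI2 : bounded_measurable (fun p : X * X => \1_I p.2 : R).
Proof. exact: (bm_comp (f := \1_I)). Qed.

Let QI : Q1 (\1_I) = mu / (1 + mu).
Proof. by rewrite /Rintegral integral_indic// setIidl//; exact: (congr1 fine Imu). Qed.

Let Qcut : Q1 (cut mu) = 0.
Proof.
rewrite (bm_intD mD fin1); try bm.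
rewrite (bm_intZ mD fin1)// bm_int_cst// QI.
by field.
Qed.

Let Qcut2 : Q1 (fun x => cut mu x ^+ 2) = mu.
Proof.
transitivity (Q1 (fun x => (1 - mu ^+ 2) * \1_I x + mu ^+ 2)).
  by apply: eq_Rintegral => x _; rewrite /cut indicE; case: (x \in I) => /=; ring.
rewrite (bm_intD mD fin1); try bm.
rewrite (bm_intZ mD fin1)// bm_int_cst// QI.
by field.
Qed.

Lemma measurable_cut_kernel : measurable_fun setT (cut_kernel T mu).
Proof.
have [] : bounded_measurable (cut_kernel T mu) by rewrite /cut_kernel; bm.
by [].
Qed.

Lemma cut_kernelC x y : cut_kernel T mu (x, y) = cut_kernel T mu (y, x).
Proof. by rewrite /cut_kernel/= [cut _ x * _]mulrC. Qed.

(** The values are 1 - T on I x I, T + (2T - 1) mu on the mixed blocks, where [muT] gives the bound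
    by 1, and T - (2T - 1) mu^2 elsewhere. *)
Lemma cut_kernel01 p : 0 <= cut_kernel T mu p <= 1.
Proof.
have /andP[T2 T1] := T12.
have y0 : 0 <= 2 * T - 1 by lra.
have m0 : 0 <= mu by exact: ltW.
have h0 : 0 <= (2 * T - 1) * mu by rewrite mulr_ge0.
have h1 : (2 * T - 1) * mu <= 2 * T - 1 by rewrite ler_piMr.
have h2 : 0 <= (2 * T - 1) * mu * mu by rewrite mulr_ge0.
have h3 : (2 * T - 1) * mu * mu <= (2 * T - 1) * mu by rewrite ler_piMr.
have hT := muT.
rewrite /cut_kernel /cut !indicE.
by case: (p.1 \in I); case: (p.2 \in I) => /=; apply/andP; split; lra.
Qed.

Let gk (p : X * X) : R := (1 - 2 * T) * (cut mu p.1 * cut mu p.2).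

Let cut_kernelE : cut_kernel T mu = (fun p => T + gk p).
Proof. by apply/funext => p; rewrite /cut_kernel /gk; ring. Qed.

Let bgk : bounded_measurable gk. Proof. by rewrite /gk; bm. Qed.

Let Qgk : Q2 gk = 0.
Proof.
rewrite (square_int mD mD1)//=.
transitivity (Q1 (fun=> 0 : R)); last by rewrite bm_int_cst.
apply: eq_Rintegral => x _; rewrite /gk /= (bm_intZ mD fin1); last by bm.
by rewrite (bm_intZ mD fin1)// Qcut !mulr0.
Qed.

Lemma cut_kernel_edge : Q2 (cut_kernel T mu) = T.
Proof.
rewrite cut_kernelE (bm_intD msq fin2)//.
by rewrite Qgk addr0 bm_int_cst.
Qed.

(** The perturbation [gk] has zero degrees and rank one. Its only nonzero eigenvalue is (1 - 2T) mu,
    as [mu] is the squared norm of [cut mu], and its triangle integral is the cube of that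
    eigenvalue. *)
Lemma cut_kernel_triangle :
  triangle_int m D (cut_kernel T mu) = T ^+ 3 - ((2 * T - 1) * mu) ^+ 3.
Proof.
have gkC x y : gk (x, y) = gk (y, x) by rewrite /gk/= [cut _ x * _]mulrC.
rewrite cut_kernelE triangle_shift//.
have deg0 x : degree m D gk x = 0.
  rewrite /degree /gk /= (bm_intZ mD fin1); last by bm.
  by rewrite (bm_intZ mD fin1)// Qcut !mulr0.
have -> : Q1 (fun x => degree m D gk x ^+ 2) = 0.
  transitivity (Q1 (fun=> 0 : R)); last by rewrite bm_int_cst.
  by apply: eq_Rintegral => x _; rewrite deg0 expr0n.
rewrite triangle_codegree//.
have codeg p : codegree m D gk p =
    (1 - 2 * T) ^+ 2 * mu * (cut mu p.1 * cut mu p.2).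
  rewrite /codegree /gk /=.
  transitivity (Q1 (fun x => (1 - 2 * T) ^+ 2 * (cut mu p.1 * cut mu p.2) *
      cut mu x ^+ 2)); first by apply: eq_Rintegral => x _; ring.
  by rewrite (bm_intZ mD fin1); [rewrite Qcut2; ring|bm].
transitivity (T ^+ 3 + (1 - 2 * T) ^+ 3 * mu *
    Q2 (fun p => cut mu p.1 ^+ 2 * cut mu p.2 ^+ 2)).
  rewrite mulr0 addr0 -(bm_intZ msq fin2); last by bm.
  by congr (_ + _); apply: eq_Rintegral => p _; rewrite codeg /gk; ring.
rewrite (square_int mD mD1)/=; last by bm.
transitivity (T ^+ 3 + (1 - 2 * T) ^+ 3 * mu *
    Q1 (fun x => mu * cut mu x ^+ 2)).
  congr (_ + _ * _); apply: eq_Rintegral => x _.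
  by rewrite (bm_intZ mD fin1)//; [rewrite Qcut2 mulrC|bm].
by rewrite (bm_intZ mD fin1); [rewrite Qcut2; ring|bm].
Qed.

(* On [I x I] the kernel equals [1 - T], where the parabola touches the rate
   function; elsewhere the deviation from [T] is of order [mu]. *)
Lemma cut_kernel_rate :
  Q2 (fun p => rate (cut_kernel T mu p)) <= rate T +
    tangency T * ((2 * T - 1) * mu) ^+ 2 +
    3 * (2 * T * (1 - T))^-1 * (2 * T - 1) ^+ 2 * mu ^+ 3.
Proof.
have /andP[T2 T1] := T12.
have T01 : 0 < T < 1 by apply/andP; split; lra.
have c0 := tangency_gt0 T12.
set C := (2 * T * (1 - T))^-1.
have C0 : 0 < C by rewrite invr_gt0 !mulr_gt0//; lra.
have m0 : 0 <= mu by exact: ltW.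
have m1 := mu1.
pose w := (2 * T - 1) ^+ 2.
have w0 : 0 <= w by exact: sqr_ge0.
(* The first line is the tangent parabola with the square of [gk] kept only on I x I, where it
   equals [w]. The second line covers the chi-square excess: order mu^2 on the mixed blocks, mu^4
   off I in both variables. *)
pose bound (p : X * X) :=
  (rate T + drate T * gk p + tangency T * w * (\1_I p.1 * \1_I p.2)) +
  (C * w * mu ^+ 4 + C * w * mu ^+ 2 * \1_I p.1 + C * w * mu ^+ 2 * \1_I p.2).
have bbound : bounded_measurable bound by rewrite /bound; bm.
have ratele p : rate (cut_kernel T mu p) <= bound p.
  have chi := rate_le_chi2 T01 (cut_kernel01 p).
  have gkE : cut_kernel T mu p - T = gk p by rewrite cut_kernelE addrC addKr.
  rewrite gkE -/C in chi.
  have mu2 : 0 <= C * w * mu ^+ 2 by rewrite mulr_ge0 ?sqr_ge0// mulr_ge0// ltW.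
  have mu4 : 0 <= C * w * mu ^+ 4 by rewrite mulr_ge0 ?exprn_ge0// mulr_ge0// ltW.
  rewrite /bound; case: (boolP (p.1 \in I)) => p1; case: (boolP (p.2 \in I)) => p2.
  - have gp : gk p = 1 - T - T by rewrite /gk /cut !indicE p1 p2 /=; ring.
    have -> : cut_kernel T mu p = 1 - T by rewrite cut_kernelE gp; ring.
    have wE : (1 - T - T) ^+ 2 = w by rewrite /w; ring.
    by rewrite rate_parabola// gp wE !indicE p1 p2 /=; lra.
  - have gp : gk p ^+ 2 = w * mu ^+ 2.
      by rewrite /gk /cut /w !indicE p1 (negbTE p2) /=; ring.
    by rewrite gp in chi; rewrite !indicE p1 (negbTE p2) /=; lra.
  - have gp : gk p ^+ 2 = w * mu ^+ 2.
      by rewrite /gk /cut /w !indicE p2 (negbTE p1) /=; ring.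
    by rewrite gp in chi; rewrite !indicE p2 (negbTE p1) /=; lra.
  - have gp : gk p ^+ 2 = w * mu ^+ 4.
      by rewrite /gk /cut /w !indicE (negbTE p1) (negbTE p2) /=; ring.
    by rewrite gp in chi; rewrite !indicE (negbTE p1) (negbTE p2) /=; lra.
have QI1 : Q2 (fun p => \1_I p.1) = mu / (1 + mu).
  rewrite (square_int mD mD1)// -QI; apply: eq_Rintegral => x _ /=.
  by rewrite bm_int_cst.
have QI2 : Q2 (fun p => \1_I p.2) = mu / (1 + mu).
  by rewrite (square_int mD mD1)//= bm_int_cst.
have QI12 : Q2 (fun p => \1_I p.1 * \1_I p.2) = (mu / (1 + mu)) ^+ 2.
  rewrite (square_int mD mD1)/=; last by bm.
  transitivity (Q1 (fun x => mu / (1 + mu) * \1_I x)).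
    by apply: eq_Rintegral => x _; rewrite (bm_intZ mD fin1)// QI mulrC.
  by rewrite (bm_intZ mD fin1)// QI.
have : Q2 (fun p => rate (cut_kernel T mu p)) <= Q2 bound.
  apply: (bm_le_int msq fin2) => //.
  by apply: bm_rate; [exact: measurable_cut_kernel|exact: cut_kernel01].
move/le_trans; apply.
have -> : Q2 bound = rate T + tangency T * w * (mu / (1 + mu)) ^+ 2 +
    C * w * mu ^+ 2 * (2 * (mu / (1 + mu))) + C * w * mu ^+ 4.
  rewrite /bound (bm_intD msq fin2); try bm.
  rewrite !bm_int_affine; try bm; try by [].
  by rewrite Qgk QI1 QI2 QI12; ring.
(* The factor 3 of the error: the strips over I give 2 l mu^2 <= 2 mu^3, and mu^4 <= mu^3. *)
set l := mu / (1 + mu).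
have l0 : 0 <= l by rewrite divr_ge0//; lra.
have lmu : l <= mu by rewrite ler_pdivrMr ?ler_peMr//; lra.
have e1 : tangency T * w * l ^+ 2 <= tangency T * w * mu ^+ 2.
  have l2 : l ^+ 2 <= mu ^+ 2 by rewrite lerXn2r ?nnegrE.
  by rewrite ler_wpM2l// mulr_ge0// ltW.
have e2 : C * w * mu ^+ 2 * (2 * l) <= C * w * mu ^+ 2 * (2 * mu).
  by rewrite ler_wpM2l ?ler_pM2l// mulr_ge0 ?sqr_ge0// mulr_ge0// ltW.
have e3 : C * w * mu ^+ 4 <= C * w * mu ^+ 3.
  by rewrite ler_wpM2l ?ler_wiXn2l// mulr_ge0// ltW.
have -> : tangency T * ((2 * T - 1) * mu) ^+ 2 = tangency T * w * mu ^+ 2.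
  by rewrite /w; ring.
by rewrite -/w; lra.
Qed.

End CutKernel.
End KernelRate.

(** * Graphons *)

Section Graphons.
Variable R : realType.
Implicit Types (h : R * R -> R) (T r : R).

Local Notation mu := (@lebesgue_measure R).
Local Notation D := (`[0, 1]%classic : set R).

Let mD : measurable D. Proof. exact: measurable_itv. Qed.
Let mD1 : mu D = 1%E.
Proof. by rewrite lebesgue_measure_itv/= lte01 oppr0 adde0. Qed.

Let mu_sf : {sigma_finite_measure set (measurableTypeR R) -> \bar R} := mu.

Lemma graphon_rate_ge T r h : 2^-1 < T < 1 -> 0 <= r ->
    with_densities (T, T ^+ 3 - T ^+ 3 * r ^+ 3) h ->
  rate T + tangency T * T ^+ 2 * r ^+ 2 <= rate_graphon h.
Proof.
move=> T12 r0 [[mh h01 hC] [hT hT3]].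
(* A graphon is constrained on the unit square only; its extension by zero is symmetric and
   [0, 1]-valued everywhere, with the same integrals. *)
pose k := h \_ (@square R).
have msq : measurable (@square R) by exact: measurableX.
have mk := (measurable_restrictT h msq).1 mh.
have kE p : square p -> k p = h p by move=> sp; rewrite /k patchE mem_set.
have k01 p : 0 <= k p <= 1.
  rewrite /k patchE; case: ifPn => [/set_mem/h01//|_].
  by rewrite lexx ler01.
have kC x y : k (x, y) = k (y, x).
  rewrite /k !patchE; case: ifPn => [/set_mem sxy|nxy].
    rewrite mem_set; first exact: hC.
    by case: sxy => ? ?; split.
  rewrite ifF//; apply/negbTE; apply: contra nxy => /set_mem [? ?].
  by apply/mem_set; split.
have -> : rate_graphon h =
    \int[(mu \x mu)%E]_(p in @square R) rate (k p).
  by apply: eq_Rintegral => p /set_mem sp; rewrite kE.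
apply: (kernel_rate_ge (m := mu_sf) mD mD1 T12 r0 mk k01 kC).
  rewrite -[RHS]hT; apply: eq_Rintegral => p /set_mem sp; exact: kE.
rewrite -[RHS]hT3; apply: eq_Rintegral => -[[x y] z] /set_mem [[/= Dx Dy] Dz].
by congr (_ * _ * _); apply: kE; split.
Qed.

Lemma graphon_rate_le T r : 2^-1 < T < 1 -> 0 < r ->
    T * r <= 1 - T -> T * r <= 2 * T - 1 ->
  exists2 h, with_densities (T, T ^+ 3 - T ^+ 3 * r ^+ 3) h &
    rate_graphon h <= rate T + tangency T * T ^+ 2 * r ^+ 2 +
      3 * (2 * T * (1 - T))^-1 * T ^+ 3 / (2 * T - 1) * r ^+ 3.
Proof.
move=> T12 r0 rT1 rT2; have /andP[T2 T1] := T12.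
have y0 : 0 < 2 * T - 1 by lra.
have y0' : 2 * T - 1 != 0 by rewrite gt_eqF.
(* Chosen so that the triangle deficit ((2T - 1) s)^3 of the test kernel is (T r)^3. *)
pose s := T * r / (2 * T - 1).
have s0 : 0 < s by rewrite divr_gt0// mulr_gt0//; lra.
have s1 : s <= 1 by rewrite ler_pdivrMr// mul1r.
have sE : (2 * T - 1) * s = T * r by rewrite mulrC divfK.
have sT : (2 * T - 1) * s <= 1 - T by rewrite sE.
pose I := `[0, s / (1 + s)]%classic : set R.
have mI : measurable I by exact: measurable_itv.
have l0 : 0 < s / (1 + s) by rewrite divr_gt0// addr_gt0.
have l1 : s / (1 + s) <= 1 by rewrite ler_pdivrMr ?addr_gt0// mul1r lerDr.
have ID : I `<=` D.
  move=> x; rewrite /I /= !in_itv/= => /andP[-> xl]; exact: le_trans l1.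
have Is : mu I = (s / (1 + s))%:E.
  by rewrite lebesgue_measure_itv/= lte_fin l0 oppr0 adde0.
pose h := cut_kernel I T s.
exists h.
  split; first split.
  - by apply: measurable_funTS; exact: measurable_cut_kernel.
  - by move=> p _; exact: cut_kernel01.
  - by move=> x y _; exact: cut_kernelC.
  - congr (_, _).
      exact: (cut_kernel_edge (m := mu_sf) mD mD1 mI ID T s0 Is).
    rewrite -exprMn -sE.
    exact: (cut_kernel_triangle (m := mu_sf) mD mD1 mI ID T s0 Is).
have := cut_kernel_rate (m := mu_sf) mD mD1 mI ID T12 s0 s1 sT Is.
move/le_trans; apply; rewrite sE exprMn mulrA lerD2l /s.
by rewrite le_eqVlt; apply/orP; left; apply/eqP; field; lra.
Qed.

(** On the constraint set the linear term is constant, so the supremum amounts to the infimum of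
    [rate_graphon], which the two preceding lemmas enclose. *)
Lemma constrained_sup_bounds T r (th : R * R)
    (t2 := T ^+ 3 - T ^+ 3 * r ^+ 3) : 2^-1 < T < 1 -> 0 < r ->
    T * r <= 1 - T -> T * r <= 2 * T - 1 ->
  0 <= dot th (T, t2) - constrained_sup (T, t2) th
       - (rate T + tangency T * T ^+ 2 * r ^+ 2)
    <= 3 * (2 * T * (1 - T))^-1 * T ^+ 3 / (2 * T - 1) * r ^+ 3.
Proof.
move=> T12 r0 rT1 rT2.
have [h hT hle] := graphon_rate_le T12 r0 rT1 rT2.
rewrite /constrained_sup; set A := [set _ | _ in _].
have Aub : ubound A (dot th (T, t2) - (rate T + tangency T * T ^+ 2 * r ^+ 2)).
  move=> _ [k kT <-]; have := graphon_rate_ge T12 (ltW r0) kT.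
  by case: kT => _ ->; rewrite lerD2l lerN2.
have Ah : A (dot th (T, t2) - rate_graphon h).
  by exists h => //; case: hT => _ ->.
have h1 : sup A <= dot th (T, t2) - (rate T + tangency T * T ^+ 2 * r ^+ 2).
  by apply: ge_sup => //; exists (dot th (T, t2) - rate_graphon h).
have h2 : dot th (T, t2) - rate_graphon h <= sup A.
  apply: ub_le_sup => //.
  by exists (dot th (T, t2) - (rate T + tangency T * T ^+ 2 * r ^+ 2)).
by apply/andP; split; lra.
Qed.

End Graphons.

(** * Asymptotics *)

Lemma derivable0_le_linear (R : realType) (F : R -> R) : derivable F 0 1 ->
  exists2 K, 0 <= K & \forall e \near (0 : R)^', `|F e - F 0| <= K * `|e|.
Proof.
move=> /cvg_ex[l /cvgrPdist_lt/(_ 1 ltr01) Fl]; exists (`|l| + 1) => //.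
near=> e.
have e0 : e != 0 by near: e; exact: nbhs_dnbhs_neq.
have : `|l - e^-1 *: (F (e *: 1 + 0) - F 0)| < 1 by near: e.
rewrite addr0 /GRing.scale/= mulr1 => h.
have : `|e^-1 * (F e - F 0)| <= `|l| + 1.
  rewrite -[X in `|X|](subKr l) (le_trans (ler_normB _ _))// lerD2l; exact: ltW.
by rewrite normrM normfV mulrC ler_pdivrMr// normr_gt0.
Unshelve. all: by end_near. Qed.

(** Carries estimates in the deviation of the triangle density over to e, the deviation being -T^3
    e. *)
Lemma near_dnbhs_right_scale (R : realType) (a : R) (P : set R) : a != 0 ->
  (\forall e \near (0 : R)^', P e) -> \forall x \near (0 : R)^'+, P (a * x).
Proof.
move=> a0 P0.
have ca : a * x @[x --> (0 : R)] --> (0 : R).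
  by rewrite -[X in _ --> X](mulr0 a); exact: mulrl_continuous.
have := ca _ P0; rewrite /= => H.
rewrite near_withinE.
apply: (@filterS _ (nbhs (0 : R)) _ _ _ _ H) => x h x0; apply: h.
by rewrite mulf_neq0// gt_eqF.
Qed.

(** The difference between f(T, x) and [tangency T * T ^+ 2] is (T/x)^2 times the height of [rate]
    above the parabola at T + x; for x < 0 this vanishes only at the second contact point 1 - T. *)
Lemma argmin_f_unique (R : realType) (T : R) : 2^-1 < T < 1 ->
  unique (argmin_f T) (1 - 2 * T) /\ f T (1 - 2 * T) = tangency T * T ^+ 2.
Proof.
move=> T12; have /andP[T2 T1] := T12.
have T01 : 0 < T < 1 by apply/andP; split; lra.
have fE : f T (1 - 2 * T) = tangency T * T ^+ 2.
  rewrite /f derive1_rate// (_ : T + (1 - 2 * T) = 1 - T); last ring.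
  rewrite rate_parabola// (_ : 1 - T - T = 1 - 2 * T); last ring.
  by field; lra.
have quot x : x != 0 -> f T x - tangency T * T ^+ 2 = T ^+ 2 / x ^+ 2 *
    (rate (T + x) - (rate T + drate T * (T + x - T) +
                     tangency T * (T + x - T) ^+ 2)).
  by move=> x0; rewrite /f derive1_rate//; field.
have wpos x : x != 0 -> 0 < T ^+ 2 / x ^+ 2.
  by move=> x0; rewrite divr_gt0// exprn_even_gt0//= gt_eqF//; lra.
have yT : - T < 1 - 2 * T < 0 by apply/andP; split; lra.
split=> //; split.
  split=> //.
  move=> x /andP[xT x0]; have xn0 : x != 0 by rewrite lt_eqF.
  rewrite fE -subr_ge0 quot// mulr_ge0 ?(ltW (wpos _ xn0))// subr_ge0.
  by apply: rate_ge_parabola => //; apply/andP; split; lra.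
move=> x [/andP[xT x0] /(_ _ yT)]; rewrite fE => fx.
have xn0 : x != 0 by rewrite lt_eqF.
apply/eqP; apply: contraT => xy; move: fx; rewrite leNgt => /negP[].
rewrite -subr_gt0 quot// mulr_gt0 ?wpos// subr_gt0.
apply: rate_gt_parabola => //; first by apply/andP; split; lra.
  by rewrite -subr_eq0 addrAC subrr add0r.
by apply: contra xy => /eqP Tx; apply/eqP; lra.
Qed.

Unset Implicit Arguments.

Theorem theorem5 (R : realType) (T : R)
    (thstar : R -> R * R) (t th : R -> nat -> R * R)
    (hT : 2^-1 < T < 1)
    (hseq : \forall e \near (0 : R),
       ensemble_sequences (T, T ^+ 3 + e) (thstar e) (t e) (th e))
    (hvar : \forall e \near (0 : R),
       variational_formula (T, T ^+ 3 + e) (thstar e) (t e) (th e))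
    (hA1 : assumption1 T thstar)
    (hA2 : assumption2 T) :
  exists y : R,
    [/\ unique (argmin_f T) y,
        e `^ (- (2 / 3)) * s_infty (t (- T ^+ 3 * e)) (th (- T ^+ 3 * e))
          @[e --> (0 : R)^'+] --> f T y
      & 0 < f T y].
Proof.
have /andP[T2 T1] := hT.
have T0 : 0 < T by lra.
have y0 : 0 < 2 * T - 1 by lra.
have [ymin fy] := @argmin_f_unique _ _ hT.
exists (1 - 2 * T); split => //; last first.
  by rewrite fy mulr_gt0 ?tangency_gt0// exprn_gt0.
rewrite fy.
have [[sm1 sm2] _ th20 /eqO_exP[k k0 hO]] := hA1.
have [|K1 K10 lip1] := @derivable0_le_linear _ (fun e => (thstar e).1).
  (* Order 0 of [smooth_near] is differentiability of the multiplier itself. *)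
  exact: (nbhs_singleton sm1 0%N).
have [|K2 K20 lip2] := @derivable0_le_linear _ (fun e => (thstar e).2).
  exact: (nbhs_singleton sm2 0%N).
pose G : R := derive1 (fun e : R => (thstar e).1) 0 * T +
  derive1 (fun e : R => (thstar e).2) 0 * T ^+ 3.
pose a1 : R := (thstar 0).1.
pose C : R := 3 * (2 * T * (1 - T))^-1 * T ^+ 3 / (2 * T - 1).
(* Collects the errors of order e: [C] from the test kernel, [k] from the remainder in Assumption 1,
   [G] from its linear term, [K1] and [K2] from the variation of the multipliers. *)
pose K : R := C + T ^+ 3 * (k + `|G| + K1 * T + K2).
pose s e := s_infty (t e) (th e).
have sE : \forall e \near (0 : R)^', s e =
    free_sup (thstar e) - constrained_sup (T, T ^+ 3 + e) (thstar e).
  have := @nbhs_dnbhs _ (0 : R) _ hvar; apply: filterS => e.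
  by move=> /cvg_lim; apply; exact: norm_hausdorff.
have freeE : \forall e \near (0 : R)^',
    `|free_sup (thstar e) - (a1 * T - rate T + G * e)| <= k * `|e ^+ 2|.
  exact: (@nbhs_dnbhs _ (0 : R) _ hO).
have lip2' : \forall e \near (0 : R)^', `|(thstar e).2| <= K2 * `|e|.
  by apply: filterS lip2 => e; rewrite th20 subr0.
have T30 : 0 < T ^+ 3 by rewrite exprn_gt0.
have T31 : T ^+ 3 <= 1 by rewrite exprn_ile1// ltW.
have T3 : - T ^+ 3 != 0 by rewrite oppr_eq0 gt_eqF.
have r_small (eta : R) : 0 < eta -> \forall e \near (0 : R)^'+, e `^ (1 / 3) <= eta.
  move=> eta0; have p3 : 0 < 1 / 3 :> R by lra.
  have /cvgrPdist_lt/(_ _ eta0) := powR_cvg0 p3.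
  apply: filterS => e; rewrite sub0r normrN ger0_norm ?powR_ge0//; exact: ltW.
have main : \forall e \near (0 : R)^'+,
    `|e `^ (- (2 / 3)) * s (- T ^+ 3 * e) - tangency T * T ^+ 2|
      <= K * e `^ (1 / 3).
  have hs := @near_dnbhs_right_scale _ _ _ T3 sE.
  have hk := @near_dnbhs_right_scale _ _ _ T3 freeE.
  have h1 := @near_dnbhs_right_scale _ _ _ T3 lip1.
  have h2 := @near_dnbhs_right_scale _ _ _ T3 lip2'.
  have hr1 : \forall e \near (0 : R)^'+, e `^ (1 / 3) <= 1 - T.
    by apply: r_small; lra.
  have hr2 := r_small _ y0.
  near=> e.
  have e0 : 0 < e by near: e; exact: nbhs_right_gt.
  have e1 : e < 1 by near: e; exact: nbhs_right_lt.
  have sd : s (- T ^+ 3 * e) = free_sup (thstar (- T ^+ 3 * e)) -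
      constrained_sup (T, T ^+ 3 + - T ^+ 3 * e) (thstar (- T ^+ 3 * e)).
    by near: e.
  have hkd : `|free_sup (thstar (- T ^+ 3 * e)) -
      (a1 * T - rate T + G * (- T ^+ 3 * e))| <= k * `|(- T ^+ 3 * e) ^+ 2|.
    by near: e.
  have h1d : `|(thstar (- T ^+ 3 * e)).1 - a1| <= K1 * `|- T ^+ 3 * e| by near: e.
  have h2d : `|(thstar (- T ^+ 3 * e)).2| <= K2 * `|- T ^+ 3 * e| by near: e.
  have r1e : e `^ (1 / 3) <= 1 - T by near: e.
  have r2e : e `^ (1 / 3) <= 2 * T - 1 by near: e.
  set d := - T ^+ 3 * e in sd hkd h1d h2d *.
  (* With r^3 = e the deviation [d] is -T^3 r^3, as in the kernel bounds, and the prefactor e^(-2/3)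
     is r^(-2). *)
  set r := e `^ (1 / 3) in r1e r2e *.
  have r0 : 0 < r by exact: powR_gt0.
  have r3 : r ^+ 3 = e.
    by rewrite /r -powR_mulrn ?powR_ge0// -powRrM divfK// powRr1// ltW.
  have rE : e `^ (- (2 / 3)) = (r ^+ 2)^-1.
    rewrite powRN; congr _^-1; rewrite /r -powR_mulrn ?powR_ge0// -powRrM.
    by congr (_ `^ _); lra.
  have rT1 : T * r <= 1 - T.
    by apply: le_trans r1e; rewrite ler_piMl// ltW.
  have rT2 : T * r <= 2 * T - 1.
    by apply: le_trans r2e; rewrite ler_piMl// ltW.
  have dr : T ^+ 3 - T ^+ 3 * r ^+ 3 = T ^+ 3 + d by rewrite r3 /d; ring.
  have := constrained_sup_bounds (thstar d) hT r0 rT1 rT2.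
  rewrite dr /dot /= -/C => /andP[X0 X1].
  have E0 : 0 <= T ^+ 3 * e by rewrite mulr_ge0 ?ltW.
  have E1 : T ^+ 3 * e <= T ^+ 3 by rewrite ler_piMr ?ltW.
  have dE : `|d| = T ^+ 3 * e by rewrite /d mulNr normrN ger0_norm.
  have Y : `|free_sup (thstar d) - (a1 * T - rate T + G * d)| <= k * (T ^+ 3 * e).
    apply: le_trans hkd _; rewrite ler_pM2l// normrX dE expr2.
    by rewrite ler_piMr// (le_trans E1).
  have Z1 : `|((thstar d).1 - a1) * T| <= K1 * (T ^+ 3 * e) * T.
    by rewrite normrM (gtr0_norm T0) ler_pM2r// -dE.
  have Z2 : `|(thstar d).2 * (T ^+ 3 + d)| <= K2 * (T ^+ 3 * e).
    rewrite -dE normrM (le_trans _ h2d)// ler_piMr// /d mulNr ger0_norm; lra.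
  have Z3 : `|G * d| <= `|G| * (T ^+ 3 * e) by rewrite normrM dE.
  (* The constants a1 T and I(T) cancel between the two suprema. What remains beside the r^2 term is
     bounded by [X1], [Y], [Z1], [Z2] and [Z3], each of order r^3. *)
  have sr : `|s d - tangency T * T ^+ 2 * r ^+ 2| <= K * r ^+ 3.
    rewrite r3 in X1; rewrite r3 sd /K.
    move: Y Z1 Z2 Z3; rewrite !ler_norml.
    move=> /andP[? ?] /andP[? ?] /andP[? ?] /andP[? ?].
    by apply/andP; split; lra.
  rewrite rE -/r.
  have r2 : 0 < r ^+ 2 by rewrite exprn_gt0.
  rewrite (_ : _ - _ = (r ^+ 2)^-1 * (s d - tangency T * T ^+ 2 * r ^+ 2)); last first.
    by field; rewrite gt_eqF.
  rewrite normrM gtr0_norm ?invr_gt0// mulrC ler_pdivrMr//.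
  by apply: le_trans sr _; rewrite exprS mulrA.
have K0 : K * e `^ (1 / 3) @[e --> (0 : R)^'+] --> (0 : R).
  rewrite -[X in _ --> X](mulr0 K).
  by apply: cvgMr; apply: powR_cvg0; lra.
apply/cvgrPdist_le => eta eta0.
move/cvgrPdist_le : K0 => /(_ _ eta0) K0.
near=> e; rewrite distrC; apply: (@le_trans _ _ (K * e `^ (1 / 3))).
  by near: e.
have : `|0 - K * e `^ (1 / 3)| <= eta by near: e.
by rewrite sub0r normrN; apply: le_trans; exact: ler_norm.
Unshelve. all: by end_near.
Qed.
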